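(* Consider the differential game with initial condition $x\in\mathbb{R}_+^I$ described in the context. Suppose there exists a continuous map $f:\mathbb{R}_+\to\mathbb{R}_+^I$ such that for all $w\in\mathbb{R}_+$, $\theta\cdot f(w)=w$, $h(f(w))=\inf\{h(q):q\in\mathbb{R}_+^I,\theta\cdot q=w\}$ and $g(f(w))=\inf\{g(q):q\in\mathbb{R}_+^I,\theta\cdot q=w\}$. For $\psi=(\psi^1,\psi^2)\in\mathcal{P}$ define $$\boldsymbol\xi[\psi](t)=x+yt+\psi^1(t)-\boldsymbol\rho[\psi^2](t),\quad \mathbf{w}[\psi]=\Gamma[\theta\cdot\boldsymbol\xi[\psi]],\quad \boldsymbol\varphi[\psi]=f(\mathbf{w}[\psi]),\quad \boldsymbol\zeta[\psi]=\boldsymbol\varphi[\psi]-\boldsymbol\xi[\psi],$$ where $\Gamma[z](t)=z(t)-\inf_{s\in[0,t]}[z(s)\wedge0]$, $t\in[0,T]$. Then $\boldsymbol\zeta$ is an admissible strategy, i.e. $\boldsymbol\zeta\in A_x$. Moreover, it is a minimizing strategy, namely $$V(x)=\sup_{\psi\in\mathcal{P}}c(\psi,\boldsymbol\zeta[\psi]).$$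
   Context: Notation. $\mathbb{R}_+=[0,\infty)$; $\|\cdot\|$ is the Euclidean norm. $T>0$ is fixed, $I\in\mathbb{N}$. $\mathcal{C}([0,T],\mathbb{R}^k)$ and $\mathcal{D}([0,T],\mathbb{R}^k)$ are the continuous, resp. right-continuous with finite left limits, functions. Data. For $i=1,\dots,I$: constants $\lambda_i,\mu_i,\sigma_{i,IA}^2,\sigma_{i,ST}^2\in(0,\infty)$ and $\tilde\lambda_i,\tilde\mu_i\in\mathbb{R}$; $\rho_i=\lambda_i/\mu_i$ with $\sum_{i=1}^I\rho_i=1$; $\theta=(1/\mu_1,\dots,1/\mu_I)$; $y_i=\tilde\lambda_i-\rho_i\tilde\mu_i$, $y=(y_1,\dots,y_I)$. $h,g:\mathbb{R}_+^I\to\mathbb{R}$ are nonnegative, continuous, nondecreasing for the componentwise partial order, and of at most linear growth: $g(q)+h(q)\le c_1\|q\|+c_2$ for some constants $c_1,c_2$. Rate function. For $\psi=(\psi^1,\psi^2)\in\mathcal{D}([0,T],\mathbb{R}^{2I})$ with $\psi^1,\psi^2$ being $\mathbb{R}^I$-valued, $\mathbb{I}(\psi)=\mathbb{I}_1(\psi^1)+\mathbb{I}_2(\psi^2)$, where $\mathbb{I}_1(\phi)=\frac12\sum_{i=1}^I\frac{1}{\lambda_i\sigma_{i,IA}^2}\int_0^T\dot\phi_i(s)^2ds$ and $\mathbb{I}_2(\phi)=\frac12\sum_{i=1}^I\frac{1}{\mu_i\sigma_{i,ST}^2}\int_0^T\dot\phi_i(s)^2ds$ if all $\phi_i$ are absolutely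 continuous and $\phi(0)=0$, and both are $+\infty$ otherwise. Differential game. $\mathcal{P}$ is the set of $\psi\in\mathcal{C}([0,T],\mathbb{R}^{2I})$ with $\psi(0)=0$; $\mathcal{E}$ is the set of $\zeta\in\mathcal{C}([0,T],\mathbb{R}^I)$ such that $\theta\cdot\zeta$ starts from zero and is nondecreasing; both have the uniform topology. Let $\boldsymbol\rho[\phi]_i(t)=\phi_i(\rho_it)$. For $\psi=(\psi^1,\psi^2)\in\mathcal{P}$, $\zeta\in\mathcal{E}$ the dynamics are $\varphi_i(t)=x_i+y_it+\psi_i^1(t)-\boldsymbol\rho[\psi^2]_i(t)+\zeta_i(t)$. A strategy is a measurable map $\alpha:\mathcal{P}\to\mathcal{E}$ that is causal: for all $\psi,\tilde\psi\in\mathcal{P}$ and $t\in[0,T]$, if $(\psi^1,\boldsymbol\rho[\psi^2])(s)=(\tilde\psi^1,\boldsymbol\rho[\tilde\psi^2])(s)$ for all $s\in[0,t]$ then $\alpha[\psi](s)=\alpha[\tilde\psi](s)$ for all $s\in[0,t]$. It is admissible, $\alpha\in A_x$, if for every $\psi\in\mathcal{P}$ the dynamics $\varphi$ corresponding to $(\psi,\alpha[\psi])$ satisfy $\varphi_i(t)\ge0$ for all $i$ and $t$. With $c(\psi,\zeta)=\int_0^Th(\varphi(t))dt+g(\varphi(T))-\mathbb{I}(\psi)$, the value of the game is $V(x)=\inf_{\alpha\in A_x}\sup_{\psi\in\mathcal{P}}c(\psi,\alpha[\psi])$. *)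

(* Defs.v *)
From HB Require Import structures.
From mathcomp Require Import all_boot all_order all_algebra.
From mathcomp Require Import all_classical all_reals all_analysis.
Export numFieldNormedType.Exports.

Set Implicit Arguments.
Unset Strict Implicit.
Unset Printing Implicit Defensive.
Import Order.TTheory GRing.Theory Num.Theory.
Local Open Scope classical_set_scope.
Local Open Scope ring_scope.

Definition dot (R : realType) (n : nat) (u v : 'rV[R]_n) : R :=
  \sum_(i < n) u 0 i * v 0 i.

(* The library norm on 'rV[R]_n is the sup norm. *)
Definition euclidean_norm (R : realType) (n : nat) (u : 'rV[R]_n) : R :=
  Num.sqrt (dot u u).

Definition orthant (R : realType) (n : nat) : set 'rV[R]_n :=
  [set q | forall i, 0 <= q 0 i].

Definition absolutely_continuous (R : realType) (a b : R) (F : R -> R) : Prop :=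
  forall e : R, 0 < e -> exists2 d : R, 0 < d &
    forall (m : nat) (u v : 'I_m -> R),
      (forall k, a <= u k /\ u k <= v k /\ v k <= b) ->
      trivIset setT (fun k => `]u k, v k[%classic) ->
      \sum_(k < m) (v k - u k) < d ->
      \sum_(k < m) `|F (v k) - F (u k)| < e.

(* Borel sigma-algebra of the subspace S of X, as a family of subsets of S. *)
Definition borel_sets (X : topologicalType) (S : set X) : set (set X) :=
  <<s S, [set S `&` U | U in [set U | open U]] >>.

Record game_data (R : realType) (n : nat) := GameData {
  horizon : R;
  arr_rate : 'I_n -> R;          (* lambda_i *)
  srv_rate : 'I_n -> R;          (* mu_i *)
  arr_var : 'I_n -> R;           (* sigma_{i,IA}^2 *)
  srv_var : 'I_n -> R;           (* sigma_{i,ST}^2 *)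
  arr_pert : 'I_n -> R;          (* tilde lambda_i *)
  srv_pert : 'I_n -> R;          (* tilde mu_i *)
  run_cost : 'rV[R]_n -> R;      (* h; only its values on the orthant matter *)
  end_cost : 'rV[R]_n -> R       (* g; only its values on the orthant matter *)
}.

Section game.
Context (R : realType) (n : nat) (G : game_data R n).
Local Notation T := (horizon G).
Local Notation h := (run_cost G).
Local Notation g := (end_cost G).

(* A path on [0, T] is represented by a function on the whole line whose
   values outside [0, T] are irrelevant.  Accordingly the space of paths
   carries the topology of uniform convergence on [0, T], in which functions
   agreeing on [0, T] are indistinguishable. *)
Local Notation control := (R -> 'rV[R]_n).
Local Notation perturbation := (R -> 'rV[R]_n * 'rV[R]_n).

Definition rho (i : 'I_n) : R := arr_rate G i / srv_rate G i.

Definition theta : 'rV[R]_n := \row_i (srv_rate G i)^-1.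

Definition drift : 'rV[R]_n := \row_i (arr_pert G i - rho i * srv_pert G i).

Definition time_change (phi : control) : control :=
  fun t => \row_i phi (rho i * t) 0 i.

(* The derivative is taken in R, so it is the derivative of the path at every
   interior point of [0, T]; where it does not exist (a null set for an
   absolutely continuous path) the value is immaterial. *)
Definition rate_component (v : 'I_n -> R) (phi : control) : \bar R :=
  if `[< (forall i, absolutely_continuous 0 T (fun t => phi t 0 i)) /\
         phi 0 = 0 >]
  then ((2^-1)%:E * \sum_(i < n) ((v i)^-1%:E *
          \int[lebesgue_measure]_(s in `[0%R, T])
             (derive1 (fun t => phi t 0 i) s ^+ 2)%:E))%E
  else +oo%E.

Definition rate1 : control -> \bar R :=
  rate_component (fun i => arr_rate G i * arr_var G i).

Definition rate2 : control -> \bar R :=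
  rate_component (fun i => srv_rate G i * srv_var G i).

Definition rate (psi : perturbation) : \bar R :=
  (rate1 (fun t => (psi t).1) + rate2 (fun t => (psi t).2))%E.

Definition perturbations : set perturbation :=
  [set psi : perturbation | {within `[0, T], continuous psi} /\ psi 0 = 0].

Definition controls : set control :=
  [set zeta : control | [/\ {within `[0, T], continuous zeta},
                  dot theta (zeta 0) = 0 &
                  {in `[0, T] &, {homo (fun t => dot theta (zeta t)) :
                                    s t / s <= t}}]].

Definition perturbation_borel : set (set perturbation) :=
  @borel_sets {uniform` `[0, T] -> 'rV[R]_n * 'rV[R]_n} perturbations.

Definition control_borel : set (set control) :=
  @borel_sets {uniform` `[0, T] -> 'rV[R]_n} controls.

Definition free_dynamics (x : 'rV[R]_n) (psi : perturbation) : control :=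
  fun t => x + t *: drift + (psi t).1 - time_change (fun s => (psi s).2) t.

Definition dynamics (x : 'rV[R]_n) (psi : perturbation) (zeta : control) :
    control :=
  fun t => free_dynamics x psi t + zeta t.

Definition measurable_strategy (alpha : perturbation -> control) : Prop :=
  forall B, control_borel B ->
    perturbation_borel (perturbations `&` alpha @^-1` B).

(* For t = T this also says that alpha psi restricted to [0, T] depends only on
   psi restricted to [0, T], so that alpha is a map between path spaces. *)
Definition causal (alpha : perturbation -> control) : Prop :=
  forall psi psi' t, perturbations psi -> perturbations psi' ->
    t \in `[0, T] ->
    (forall s, s \in `[0, t] ->
       (psi s).1 = (psi' s).1 /\
       time_change (fun r => (psi r).2) s =
         time_change (fun r => (psi' r).2) s) ->
    forall s, s \in `[0, t] -> alpha psi s = alpha psi' s.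

Definition strategy (alpha : perturbation -> control) : Prop :=
  [/\ forall psi, perturbations psi -> controls (alpha psi),
      measurable_strategy alpha &
      causal alpha].

Definition admissible (x : 'rV[R]_n) : set (perturbation -> control) :=
  [set alpha | strategy alpha /\
     forall psi, perturbations psi -> forall t, t \in `[0, T] ->
       orthant (dynamics x psi (alpha psi) t)].

Definition game_cost (x : 'rV[R]_n) (psi : perturbation) (zeta : control) :
    \bar R :=
  (\int[lebesgue_measure]_(t in `[0%R, T]) (h (dynamics x psi zeta t))%:E
   + (g (dynamics x psi zeta T))%:E - rate psi)%E.

Definition worst_cost (x : 'rV[R]_n) (alpha : perturbation -> control) :
    \bar R :=
  ereal_sup [set game_cost x psi (alpha psi) | psi in perturbations].

Definition game_value (x : 'rV[R]_n) : \bar R :=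
  ereal_inf [set worst_cost x alpha | alpha in admissible x].

Definition skorokhod (z : R -> R) : R -> R :=
  fun t => z t - inf [set Num.min (z s) 0 | s in `[0, t]].

Definition workload (x : 'rV[R]_n) (psi : perturbation) : R -> R :=
  skorokhod (fun t => dot theta (free_dynamics x psi t)).

Definition feedback_control (x : 'rV[R]_n) (f : R -> 'rV[R]_n)
    (psi : perturbation) : control :=
  fun t => f (workload x psi t) - free_dynamics x psi t.

Definition cost_function (k : 'rV[R]_n -> R) : Prop :=
  [/\ forall q, orthant q -> 0 <= k q,
      {within @orthant R n, continuous k} &
      forall q q', orthant q -> orthant q' ->
        (forall i, q 0 i <= q' 0 i) -> k q <= k q'].

Definition workload_fiber (w : R) : set 'rV[R]_n :=
  [set q | orthant q /\ dot theta q = w].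

End game.

(* Main.v *)
Require Import Defs.
From mathcomp Require Import all_boot all_order all_algebra.
From mathcomp Require Import all_classical all_reals all_analysis.
From mathcomp Require Import measurable_realfun.
From mathcomp Require Import lra.
Import Order.TTheory GRing.Theory Num.Theory.
Local Open Scope classical_set_scope.
Local Open Scope ring_scope.

(** The feedback control is optimal pathwise: against every perturbation it
    does at least as well as any admissible strategy, so that comparing
    suprema and infima is all that remains at the end.

    Project the dynamics on the direction theta.  For any admissible control
    the projected path is the free workload plus a nondecreasing process
    started at zero, and it stays nonnegative; the Skorokhod map produces the
    smallest such path ([skorokhod_minimal]), so the workload [w] of the
    feedback control is a lower bound for theta . phi ([workload_le]).  The
    costs increase with the workload when the mass is arranged optimally: a
    state [q] of workload at least [w] can be shrunk towards the origin until
    its workload is exactly [w], which lowers both costs, and [f w] is optimal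
    among the states of workload [w] ([fiber_inf_le]).  Hence both costs at
    [f w] are at most those along any competitor, while the rate term depends
    on the perturbation only ([feedback_cost_le]).

    Admissibility.  The feedback control is built so that the controlled path
    is [f w], which lies in the orthant; its projection on theta is minus the
    running infimum of the free workload, which is nondecreasing and starts at
    zero.  Causality holds because the Skorokhod map at time [t] looks at its
    argument on [0, t] only.  Measurability comes from continuity for the
    uniform topology ([feedback_continuous]): the free dynamics and the
    Skorokhod map are Lipschitz, and [f], though only continuous, is uniformly
    so near the compact range of one workload path ([near_within_uniform]). *)

(** * Relative continuity and Borel sets *)

Lemma continuous_comp_within {X Y Z : topologicalType} (A : set X) (B : set Y)
    (u : X -> Y) (v : Y -> Z) :
  (forall x, A x -> B (u x)) -> {within A, continuous u} ->
  {within B, continuous v} -> {within A, continuous (fun x => v (u x))}.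
Proof.
move=> AB /subspace_continuousP uc /subspace_continuousP vc.
apply/subspace_continuousP => x Ax W /(vc _ (AB _ Ax)) /(uc _ Ax).
rewrite !nbhs_simpl /= /within /=; apply: filterS => y Wy Ay.
exact: Wy Ay (AB _ Ay).
Qed.

Lemma within_continuous_row {R : realType} {n : nat} {X : topologicalType}
    (A : set X) (F : X -> 'rV[R]_n) :
  (forall i, {within A, continuous (fun x => F x 0 i)}) ->
  {within A, continuous F}.
Proof.
move=> Fc; apply/subspace_continuousP => x Ax W [P FP PW].
suff : \forall y \near within A (nbhs x), forall i, P 0 i (F y 0 i).
  apply: filterS => y Py; apply: PW => i j.
  by rewrite (ord1 i); exact: Py.
apply: filter_forall => i.
by move/subspace_continuousP : (Fc i) => /(_ x Ax); apply; exact: FP.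
Qed.

(** A form of the Heine-Cantor theorem in which only one of the two points is
    confined to the compact set: the workload of the perturbed path may leave
    the range [K] of the reference path. *)
Lemma near_within_uniform {R : realType} {X Y : pseudoMetricType R}
    (A K : set X) (u : X -> Y) (e : R) :
  {within A, continuous u} -> compact K -> K `<=` A -> 0 < e ->
  exists2 d : R, 0 < d &
    forall p q, K p -> A q -> ball p d q -> ball (u p) e (u q).
Proof.
move=> /subspace_continuousP uc.
move=> /compact_near_coveringP/near_covering_withinP Kc KA e0.
pose P (d : R) p := forall q, A q -> ball p d q -> ball (u p) e (u q).
have /filter_ex : \forall d \near (0 : R)^'+, 0 < d /\ K `<=` P d.
  apply: filterI; first exact: nbhs_right_gt.
  have K0 := Kc R ((0 : R)^'+) P _; apply: K0 => p Kp.
  have e20 : 0 < e / 2 by lra.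
  (* A radius r is good at p for e/2; r/2 is then good for e at all nearby q. *)
  have := uc _ (KA _ Kp) _ (nbhsx_ballx (u p) (e/2) e20).
  rewrite nbhs_simpl /= /within /= => /nbhs_ballP[r /= r0 rP].
  have r20 : 0 < r / 2 by lra.
  exists (ball p (r/2), [set d | d < r / 2]).
    by split; [exact: nbhsx_ballx|exact: nbhs_right_lt].
  move=> [q d] /= [pq dr] Kq s As qs.
  apply: (@ball_splitr _ _ (u p)).
    apply: rP; last exact: KA.
    by apply: le_ball pq; lra.
  apply: rP => //; apply: (@ball_split _ _ q) => //.
  by apply: le_ball qs; lra.
by move=> [d [d0 dP]]; exists d => // p q Kp; exact: dP.
Qed.

(** The sets whose preimage is Borel form a sigma-algebra on [S'], so it is
    enough to treat relatively open sets.  That [F] maps [S] into [S'] is what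
    makes preimages commute with complements relative to [S'] and [S]. *)
Lemma borel_preimage {X Y : topologicalType} (S : set X) (S' : set Y)
    (F : X -> Y) :
  (forall p, S p -> S' (F p)) -> {within S, continuous F} ->
  forall B, @borel_sets Y S' B -> @borel_sets X S (S `&` F @^-1` B).
Proof.
move=> SS' Fc B.
apply: (smallest_sub (X := [set B | @borel_sets X S (S `&` F @^-1` B)])).
  split => /=.
  - by rewrite preimage_set0 setI0; exact: sigma_algebra0.
  - move=> C CB; rewrite (_ : _ `&` _ = S `\` (S `&` F @^-1` C)).
      exact: sigma_algebraCD.
    apply/seteqP; split => p /=; first by move=> [Sp [_ nC]]; split => // -[].
    by move=> [Sp nC]; split => //; split; [exact: SS'|move=> Cp; apply: nC].
  - move=> C CB; rewrite preimage_bigcup setI_bigcupr.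
    exact: sigma_algebra_bigcup.
move=> _ [U oU <-] /=; apply: sub_sigma_algebra.
have /open_subspaceP[V oV VE] : open (F @^-1` U : set (subspace S)).
  by move/continuousP: Fc; exact.
exists V => //; rewrite setIC VE; apply/seteqP; split => p /=.
  by move=> [Up Sp]; do !split => //; exact: SS'.
by move=> [Sp [_ Up]].
Qed.

(** * The Skorokhod map *)

(** The nonpositive part that the Skorokhod map subtracts:
    [skorokhod z t] unfolds to [z t - running_inf z t]. *)
Definition running_inf {R : realType} (z : R -> R) (t : R) : R :=
  inf [set Num.min (z s) 0 | s in `[0, t]].

Lemma le_running_inf {R : realType} (z : R -> R) (t m : R) : 0 <= t ->
  m <= 0 -> (forall s, 0 <= s <= t -> m <= z s) -> m <= running_inf z t.
Proof.
move=> t0 m0 mz; apply: lb_le_inf.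
  by exists (Num.min (z 0) 0), 0 => //=; rewrite in_itv /= lexx.
move=> y [s /=]; rewrite in_itv /= => st <-.
by rewrite le_min m0 andbT; exact: mz.
Qed.

Lemma skorokhod_eq {R : realType} (z z' : R -> R) (t : R) : 0 <= t ->
  (forall s, 0 <= s <= t -> z s = z' s) -> skorokhod z t = skorokhod z' t.
Proof.
move=> t0 zz'; rewrite /skorokhod zz' ?t0 ?lexx //; congr (_ - inf _).
by apply: eq_imagel => s /=; rewrite in_itv /= => st; rewrite zz'.
Qed.

Section skorokhod_map.
Context {R : realType} {T : R}.
Implicit Types z l : R -> R.

(** Continuity of [z] enters through boundedness: [inf] takes a default value
    on sets that are not bounded below. *)
Lemma running_inf_le z t s : {within `[0, T], continuous z} ->
  t <= T -> 0 <= s <= t -> running_inf z t <= z s /\ running_inf z t <= 0.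
Proof.
move=> zc tT /andP[s0 st].
have T0 : 0 <= T by lra.
have [c _ zcP] := EVT_min T0 zc.
have : running_inf z t <= Num.min (z s) 0.
  apply: ge_inf; last by exists s => //=; rewrite in_itv /= s0.
  exists (Num.min (z c) 0) => y [r /=]; rewrite in_itv /= => /andP[r0 rt] <-.
  have zcr : z c <= z r by apply: zcP; rewrite in_itv /= r0; lra.
  by rewrite le_min !ge_min zcr lexx orbT.
by rewrite le_min => /andP[].
Qed.

Lemma running_inf_le0 z t : {within `[0, T], continuous z} ->
  0 <= t <= T -> running_inf z t <= 0.
Proof.
move=> zc /andP[t0 tT].
by apply: (running_inf_le z t t _ _ _).2; rewrite ?t0 /=.
Qed.

Lemma running_inf0 z : {within `[0, T], continuous z} -> 0 <= T ->
  0 <= z 0 -> running_inf z 0 = 0.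
Proof.
move=> zc T0 z0; apply/eqP; rewrite eq_le running_inf_le0 //= ?lexx //.
apply: le_running_inf => // s /andP[s0 s0'].
by have -> : s = 0 by lra.
Qed.

Lemma running_inf_nonincreasing z s t : {within `[0, T], continuous z} ->
  0 <= s -> s <= t -> t <= T -> running_inf z t <= running_inf z s.
Proof.
move=> zc s0 st tT; apply: le_running_inf => //.
  by apply: running_inf_le0 => //; lra.
by move=> r /andP[r0 rs]; apply: (running_inf_le _ _ _ _ _ _).1 => //; lra.
Qed.

Lemma skorokhod_ge0 z t : {within `[0, T], continuous z} ->
  0 <= t <= T -> 0 <= skorokhod z t.
Proof.
move=> zc /andP[t0 tT]; rewrite subr_ge0.
by apply: (running_inf_le _ _ _ _ _ _).1 => //; lra.
Qed.

(** For [s <= t], nonnegativity of [z + l] at [s] gives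
    [z s >= - l s >= - l t], and [0 >= - l t] too; so [- l t] is a lower bound
    of the family whose infimum defines the Skorokhod map at [t]. *)
Lemma skorokhod_minimal z l t : {within `[0, T], continuous z} ->
  0 <= t <= T -> 0 <= l 0 ->
  (forall s r, 0 <= s -> s <= r -> r <= T -> l s <= l r) ->
  (forall s, 0 <= s <= T -> 0 <= z s + l s) ->
  skorokhod z t <= z t + l t.
Proof.
move=> zc /andP[t0 tT] l0 lnd zl; rewrite /skorokhod lerD2l lerNl.
apply: le_running_inf => // [|s /andP[s0 st]].
  by have := lnd 0 t (lexx _) t0 tT; lra.
have sT : 0 <= s <= T by lra.
by have := zl s sT; have := lnd s t s0 st tT; lra.
Qed.

(** Common source of two estimates: with [t = t'] it compares two paths and
    gives the Lipschitz bound, with [z = z'] it compares two times and gives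
    continuity. *)
Lemma le_running_infD z z' t t' e : {within `[0, T], continuous z} ->
  {within `[0, T], continuous z'} -> 0 <= t <= T -> 0 <= t' <= T -> 0 <= e ->
  (forall s, 0 <= s <= t -> exists2 s', 0 <= s' <= t' & z' s' <= z s + e) ->
  running_inf z' t' <= running_inf z t + e.
Proof.
move=> zc zc' /andP[t0 tT] /andP[t0' tT'] e0 zz'; rewrite -lerBlDr.
have le0 : running_inf z' t' <= 0 by apply: running_inf_le0 => //; lra.
apply: le_running_inf => // [|s st]; first lra.
have [s' st' zs] := zz' s st.
have [le1 _] := running_inf_le z' t' s' zc' tT' st'.
by lra.
Qed.

Lemma skorokhod_lipschitz z z' t e : {within `[0, T], continuous z} ->
  {within `[0, T], continuous z'} -> 0 <= t <= T ->
  (forall s, 0 <= s <= T -> `|z s - z' s| <= e) ->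
  `|skorokhod z t - skorokhod z' t| <= e *+ 2.
Proof.
move=> zc zc' tT zz'.
have e0 : 0 <= e by apply: le_trans (zz' _ tT).
have le1 : running_inf z' t <= running_inf z t + e.
  apply: le_running_infD => // s st; exists s => //.
  by have /zz' : 0 <= s <= T by [lra]; rewrite ler_norml; lra.
have le2 : running_inf z t <= running_inf z' t + e.
  apply: le_running_infD => // s st; exists s => //.
  by have /zz' : 0 <= s <= T by [lra]; rewrite ler_norml; lra.
have := zz' _ tT; rewrite !ler_norml /skorokhod -!/(running_inf _ _).
by rewrite mulr2n; lra.
Qed.

Lemma running_inf_continuous z : {within `[0, T], continuous z} ->
  {within `[0, T], continuous (running_inf z)}.
Proof.
move=> zc; apply/subspace_continuousP => t /=; rewrite in_itv /= => tT.
apply/cvgrPdist_le => e e0.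
have e20 : 0 < e / 2 by lra.
have /subspace_continuousP/(_ t) := zc; rewrite /= in_itv /= => /(_ tT).
move=> /cvgrPdist_le/(_ _ e20); rewrite /within /= => /nbhs_ballP[d /= d0 dP].
apply/nbhs_ballP; exists d => //= u tu; rewrite in_itv /= => uT.
have {}dP r : `|t - r| < d -> 0 <= r <= T -> `|z t - z r| <= e / 2.
  by move=> tr rT; apply: dP => //; rewrite in_itv.
have close s s' : 0 <= s <= T -> 0 <= s' <= T -> `|t - s| < d ->
    `|t - s'| < d -> z s' <= z s + e.
  move=> sT s'T ts ts'; have := dP _ ts sT; have := dP _ ts' s'T.
  by rewrite !ler_norml; lra.
have key p q : 0 <= p <= T -> 0 <= q <= T -> `|t - p| < d -> `|t - q| < d ->
    running_inf z q <= running_inf z p + e.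
  move=> pT qT tp tq; apply: le_running_infD => // [|s sp]; first lra.
  (* Times beyond q are matched with q itself. *)
  have [sq|qs] := leP s q; first by exists s => //; lra.
  exists q; first lra.
  by apply: close => //; [lra|move: tp tq; rewrite !ltr_norml; lra].
have tt : `|t - t| < d by rewrite subrr normr0.
rewrite ler_norml; have := key t u tT uT tt tu; have := key u t uT tT tu tt.
by lra.
Qed.

Lemma skorokhod_continuous z : {within `[0, T], continuous z} ->
  {within `[0, T], continuous (skorokhod z)}.
Proof.
by move=> zc; apply: within_continuousB => //; exact: running_inf_continuous.
Qed.

End skorokhod_map.

(** * Weighted sums of coordinates *)

Lemma dotDr {R : realType} {n : nat} (u v w : 'rV[R]_n) :
  dot u (v + w) = dot u v + dot u w.
Proof. by rewrite /dot -big_split; apply: eq_bigr => i _; rewrite mxE mulrDr. Qed.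

Lemma dotZr {R : realType} {n : nat} (a : R) (u v : 'rV[R]_n) :
  dot u (a *: v) = a * dot u v.
Proof. by rewrite /dot mulr_sumr; apply: eq_bigr => i _; rewrite mxE mulrCA. Qed.

Lemma dotBr {R : realType} {n : nat} (u v w : 'rV[R]_n) :
  dot u (v - w) = dot u v - dot u w.
Proof. by rewrite dotDr -scaleN1r dotZr mulN1r. Qed.

Lemma dot_continuous {R : realType} {n : nat} (u : 'rV[R]_n) :
  continuous (dot u).
Proof.
have add_c : continuous (fun z : R * R => z.1 + z.2).
  by move=> z; apply: cvgD; [exact: cvg_fst|exact: cvg_snd].
have mul_c i : continuous (fun v : 'rV[R]_n => u 0 i * v 0 i).
  move=> v; apply: (@cvgM R _ (nbhs v)); first exact: cvg_cst.
  exact: coord_continuous.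
exact: (@continuous_big R _ _ 0 xpredT add_c _ _ _ (fun i _ => mul_c i)).
Qed.

Lemma dot_ge0 {R : realType} {n : nat} (u v : 'rV[R]_n) :
  orthant u -> orthant v -> 0 <= dot u v.
Proof. by move=> u0 v0; apply: sumr_ge0 => i _; apply: mulr_ge0. Qed.

Lemma ler_norm_dot {R : realType} {n : nat} (u v : 'rV[R]_n) (b : R) :
  orthant u -> (forall i, `|v 0 i| <= b) -> `|dot u v| <= (\sum_i u 0 i) * b.
Proof.
move=> u0 vb; rewrite (le_trans (ler_norm_sum _ _ _)) // mulr_suml.
apply: ler_sum => i _; rewrite normrM (ger0_norm (u0 i)).
by apply: ler_wpM2l.
Qed.

(** * Free dynamics and workload *)

Section game.
Context {R : realType} {n : nat} {G : game_data R n}.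
Context (arr_rate_gt0 : forall i, 0 < arr_rate G i)
  (srv_rate_gt0 : forall i, 0 < srv_rate G i)
  (critical_load : \sum_(i < n) rho G i = 1).
Local Notation T := (horizon G).
Local Notation perturbation := (R -> 'rV[R]_n * 'rV[R]_n).

Lemma theta_orthant : orthant (theta G).
Proof. by move=> i; rewrite mxE invr_ge0 ltW. Qed.

(** The critical load condition makes each [rho i] at most 1, so that the time
    change keeps [0, T] inside itself and only uses the perturbation where its
    continuity is known. *)
Lemma rho_in01 i : 0 <= rho G i <= 1.
Proof.
have rho0 j : 0 <= rho G j by rewrite divr_ge0 // ltW.
by rewrite rho0 -critical_load (bigD1 i) //= lerDl sumr_ge0.
Qed.

Lemma rho_scale_in i t : 0 <= t <= T -> 0 <= rho G i * t <= T.
Proof.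
have /andP[r0 r1] := rho_in01 i; move=> /andP[t0 tT].
by rewrite mulr_ge0 //= (le_trans _ tT) // ler_piMl.
Qed.

Lemma free_dynamicsE x psi t i :
  free_dynamics G x psi t 0 i =
  x 0 i + t * drift G 0 i + (psi t).1 0 i - (psi (rho G i * t)).2 0 i.
Proof. by rewrite !mxE. Qed.

Lemma free_dynamics_continuous x psi : perturbations G psi ->
  {within `[0, T], continuous (free_dynamics G x psi)}.
Proof.
move=> [psic _]; apply: within_continuous_row => i.
have -> : (fun t => free_dynamics G x psi t 0 i) = (fun t =>
    x 0 i + t * drift G 0 i + (psi t).1 0 i - (psi (rho G i * t)).2 0 i).
  by apply/funext => t; exact: free_dynamicsE.
have fst_c : continuous (fun p : 'rV[R]_n * 'rV[R]_n => p.1 0 i).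
  move=> p; apply: (@continuous_comp _ _ _ fst (fun v : 'rV[R]_n => v 0 i));
    [exact: cvg_fst|exact: coord_continuous].
have snd_c : continuous (fun p : 'rV[R]_n * 'rV[R]_n => p.2 0 i).
  move=> p; apply: (@continuous_comp _ _ _ snd (fun v : 'rV[R]_n => v 0 i));
    [exact: cvg_snd|exact: coord_continuous].
apply: within_continuousB.
  apply: within_continuousD.
    apply: continuous_subspaceT => t; apply: cvgD; first exact: cvg_cst.
    by apply: cvgM; [exact: cvg_id|exact: cvg_cst].
  exact: (within_continuous_comp _ psi _ (fun p _ => fst_c p)).
apply: (continuous_comp_within `[0, T]%classic `[0, T]%classic
  (fun t => rho G i * t) (fun t => (psi t).2 0 i)).
- by move=> t /=; rewrite !in_itv; exact: rho_scale_in.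
- apply: continuous_subspaceT => t.
  by apply: cvgM; [exact: cvg_cst|exact: cvg_id].
- exact: (within_continuous_comp _ psi _ (fun p _ => snd_c p)).
Qed.

Lemma free_workload_continuous x psi : perturbations G psi ->
  {within `[0, T], continuous (fun t => dot (theta G) (free_dynamics G x psi t))}.
Proof.
move=> psiP; apply: (within_continuous_comp _ (free_dynamics G x psi) (dot (theta G))).
  by move=> v _; exact: dot_continuous.
exact: free_dynamics_continuous.
Qed.

Lemma free_dynamics0 x psi : perturbations G psi -> free_dynamics G x psi 0 = x.
Proof.
move=> [_ psi0]; apply/rowP => i.
by rewrite free_dynamicsE mul0r mulr0 psi0 /= !mxE !addr0 subr0.
Qed.

(** The point [(w / theta . q) *: q] has workload [w] and lies below [q]
    componentwise, so monotonicity of [k] bounds the infimum. *)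
Lemma fiber_inf_le k q w : cost_function k -> orthant q ->
  0 <= w <= dot (theta G) q ->
  inf [set k p | p in workload_fiber G w] <= k q.
Proof.
move=> [k_ge0 _ k_homo] q0 /andP[w0 wq].
pose a := w / dot (theta G) q.
have a01 : 0 <= a <= 1.
  rewrite /a divr_ge0 ?(le_trans w0) //=.
  (* If theta . q = 0 then w = 0, and the convention 0^-1 = 0 gives a = 0. *)
  have [->|wq0] := eqVneq (dot (theta G) q) 0; first by rewrite invr0 mulr0.
  by rewrite ler_pdivrMr ?mul1r // lt_neqAle eq_sym wq0 (le_trans w0).
have aq0 : orthant (a *: q) by move=> i; rewrite mxE mulr_ge0 //; lra.
have aqw : dot (theta G) (a *: q) = w.
  rewrite dotZr /a; have [wq0|wq0] := eqVneq (dot (theta G) q) 0.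
    by rewrite wq0 mulr0; move: wq; rewrite wq0; lra.
  by rewrite divfK.
apply: (@le_trans _ _ (k (a *: q))).
  apply: ge_inf; last by exists (a *: q).
  by exists 0 => y [p [p0 _] <-]; exact: k_ge0.
by apply: k_homo => // i; rewrite mxE ler_piMl //; lra.
Qed.

Lemma workload_ge0 x psi t : perturbations G psi -> 0 <= t <= T ->
  0 <= workload G x psi t.
Proof. by move=> psiP; apply/skorokhod_ge0/free_workload_continuous. Qed.

Lemma workload_continuous x psi : perturbations G psi ->
  {within `[0, T], continuous (workload G x psi)}.
Proof. by move=> psiP; apply/skorokhod_continuous/free_workload_continuous. Qed.

(** The projection of an admissible control on theta is one of the competitors
    over which the Skorokhod map is minimal. *)
Lemma workload_le x psi zeta t : perturbations G psi -> controls G zeta ->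
  (forall s, 0 <= s <= T -> orthant (dynamics G x psi zeta s)) ->
  0 <= t <= T -> workload G x psi t <= dot (theta G) (dynamics G x psi zeta t).
Proof.
move=> psiP [_ zeta0 zeta_nd] dyn0 tT; rewrite dotDr.
apply: (skorokhod_minimal _ (fun t => dot (theta G) (zeta t)) _
  (free_workload_continuous x psi psiP) tT).
- by rewrite zeta0.
- by move=> s r s0 sr rT; apply: zeta_nd => //; rewrite in_itv /=; lra.
- by move=> s sT; rewrite -dotDr; apply: dot_ge0; [exact: theta_orthant|exact: dyn0].
Qed.

(** * The feedback control *)

Section feedback.
Context (f : R -> 'rV[R]_n)
  (f_continuous : {within `[0, +oo[, continuous f})
  (f_orthant : forall w : R, 0 <= w -> orthant (f w))
  (f_workload : forall w : R, 0 <= w -> dot (theta G) (f w) = w).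
Context (x : 'rV[R]_n).

Lemma dynamics_feedback psi t :
  dynamics G x psi (feedback_control G x f psi) t = f (workload G x psi t).
Proof. by rewrite /dynamics /feedback_control addrC subrK. Qed.

Lemma feedback_path_continuous psi : perturbations G psi ->
  {within `[0, T], continuous (fun t => f (workload G x psi t))}.
Proof.
move=> psiP; apply: continuous_comp_within (workload_continuous x psi psiP)
  f_continuous.
by move=> t /=; rewrite !in_itv /= andbT; exact: workload_ge0.
Qed.

(** The constraint that [f w] carries workload [w] makes the projected control
    the regulator of the Skorokhod problem, from which its initial value and
    its monotonicity are read off. *)
Lemma theta_feedback psi t : perturbations G psi -> 0 <= t <= T ->
  dot (theta G) (feedback_control G x f psi t) =
  - running_inf (fun s => dot (theta G) (free_dynamics G x psi s)) t.
Proof.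
move=> psiP tT; rewrite dotBr f_workload; last exact: workload_ge0.
by rewrite addrAC subrr sub0r.
Qed.

Lemma feedback_controls psi : orthant x -> perturbations G psi -> 0 <= T ->
  controls G (feedback_control G x f psi).
Proof.
move=> x0 psiP T0; have zc := free_workload_continuous x psi psiP; split.
- by move=> t; apply: cvgB;
    [exact: feedback_path_continuous|exact: free_dynamics_continuous].
- rewrite theta_feedback ?lexx // (running_inf0 _ zc) ?oppr0 //.
  by rewrite free_dynamics0 //; apply: dot_ge0 => //; exact: theta_orthant.
- move=> s t; rewrite !in_itv /= => sT tT st; rewrite !theta_feedback // lerN2.
  by apply: (running_inf_nonincreasing _ _ _ zc) => //; lra.
Qed.

Lemma feedback_causal : causal G (feedback_control G x f).
Proof.
move=> psi psi' t psiP psiP' tT eq_psi s; rewrite in_itv /= => st.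
have eq_free r : 0 <= r <= t -> free_dynamics G x psi r = free_dynamics G x psi' r.
  move=> rt; have [|e1 e2] := eq_psi r; first by rewrite in_itv.
  by rewrite /free_dynamics e1 e2.
rewrite /feedback_control eq_free //; congr (f _ - _).
by apply: skorokhod_eq => [|r rs]; [lra|rewrite eq_free //; lra].
Qed.

Lemma free_dynamics_lipschitz (psi psi' : perturbation) (d : R) t :
  (forall s, 0 <= s <= T -> ball (psi s) d (psi' s)) -> 0 <= t <= T ->
  forall i, `|(free_dynamics G x psi t - free_dynamics G x psi' t) 0 i| <= d *+ 2.
Proof.
move=> psid tT i; rewrite mxE [X in _ + X]mxE !free_dynamicsE.
have [[_ ball1] _] := psid _ tT.
have [_ [_ ball2]] := psid _ (rho_scale_in i t tT).
have := ball1 0 i; have := ball2 0 i.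
rewrite /ball /= !ltr_norml ler_norml mulr2n; lra.
Qed.

(** A perturbation moved by [d] moves each coordinate of the free dynamics by
    at most [2 d], the free workload by [2 C d] with [C] the sum of the
    coordinates of theta, and the workload by [4 C d]; [d] is chosen to make
    this less than the modulus [r] of [f], and [2 d] at most [e / 2]. *)
Lemma feedback_continuous :
  continuous (feedback_control G x f :
    subspace (perturbations G : set {uniform` `[0, T] -> 'rV[R]_n * 'rV[R]_n}) ->
    {uniform` `[0, T] -> 'rV[R]_n}).
Proof.
apply/subspace_continuousP => psi psiP W /uniform_nbhs[E [entE EW]].
have [e /= e0 eE] : filter_from [set e : R | 0 < e]
    (fun e => [set uv : 'rV[R]_n * 'rV[R]_n | ball uv.1 e uv.2]) E.
  by rewrite entourage_from_ballE.
have e20 : 0 < e / 2 by lra.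
pose K := workload G x psi @` `[0, T].
have Kc : compact K.
  by apply: continuous_compact; [exact: workload_continuous|exact: segment_compact].
have K0 : K `<=` `[0, +oo[%classic.
  move=> y [t /=]; rewrite !in_itv /= andbT => tT <-; exact: workload_ge0.
have [r r0 fr] := near_within_uniform _ _ _ _ f_continuous Kc K0 e20.
pose C := \sum_i theta G 0 i.
have C0 : 0 <= C by apply: sumr_ge0 => i _; exact: theta_orthant.
(* With C + 1 instead of C the denominator is visibly positive and 4 C d is
   strictly below r. *)
pose d := Num.min (e / 4) (r / (4 * (C + 1))).
have d0 : 0 < d by rewrite lt_min !divr_gt0 //; lra.
have de : d <= e / 4 by rewrite ge_min lexx.
have dr : d * (4 * (C + 1)) <= r.
  by rewrite -ler_pdivlMr ?ge_min ?lexx ?orbT //; lra.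
apply/uniform_nbhs; exists [set uv | ball uv.1 d uv.2]; split.
  by rewrite -entourage_from_ballE; exists d.
move=> psi' psid psiP'; apply: EW => t tT; apply: eE => /=.
have {}psid s : 0 <= s <= T -> ball (psi s) d (psi' s).
  by move=> sT; apply: psid; rewrite /= in_itv.
have tT' : 0 <= t <= T by move: tT; rewrite /= in_itv.
have free_d s := free_dynamics_lipschitz psi psi' d s psid.
have wd : `|workload G x psi t - workload G x psi' t| < r.
  apply: (@le_lt_trans _ _ ((C * (d *+ 2)) *+ 2)).
    apply: skorokhod_lipschitz tT' _; [exact: free_workload_continuous..|].
    move=> s sT; rewrite -dotBr; apply: ler_norm_dot; first exact: theta_orthant.
    exact: free_d.
  by rewrite (lt_le_trans _ dr) // !mulr2n; nra.
have [|||_ fd] := fr (workload G x psi t) (workload G x psi' t).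
- by exists t.
- by rewrite /= in_itv /= andbT; exact: workload_ge0.
- exact: wd.
split => // i j; rewrite (ord1 i) {i}.
have := fd 0 j; have := free_d t tT' j; rewrite /feedback_control.
move: (free_dynamics G x psi t) (free_dynamics G x psi' t) => u v.
move: (f (workload G x psi t)) (f (workload G x psi' t)) => p q.
rewrite /ball /= !mxE (mulr2n d) !ler_norml !ltr_norml; lra.
Qed.

Lemma feedback_admissible : orthant x -> 0 <= T ->
  admissible G x (feedback_control G x f).
Proof.
move=> x0 T0; have feedP psi := feedback_controls psi x0 ^~ T0.
split; last first.
  move=> psi psiP t; rewrite in_itv /= => tT; rewrite dynamics_feedback.
  exact/f_orthant/workload_ge0.
split => //; last exact: feedback_causal.
by move=> B; apply: borel_preimage => //; exact: feedback_continuous.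
Qed.

(** Both costs are compared pointwise in time; the rate terms of the two sides
    coincide, so adding them preserves the inequality even when they are
    infinite. *)
Lemma feedback_cost_le psi zeta : perturbations G psi -> controls G zeta ->
  cost_function (run_cost G) -> cost_function (end_cost G) -> 0 <= T ->
  (forall w : R, 0 <= w ->
     run_cost G (f w) = inf [set run_cost G q | q in workload_fiber G w]) ->
  (forall w : R, 0 <= w ->
     end_cost G (f w) = inf [set end_cost G q | q in workload_fiber G w]) ->
  (forall t, 0 <= t <= T -> orthant (dynamics G x psi zeta t)) ->
  (game_cost G x psi (feedback_control G x f psi) <= game_cost G x psi zeta)%E.
Proof.
move=> psiP zetaP runP endP T0 f_run f_end dyn0.
have cost_le k t : cost_function k -> 0 <= t <= T ->
    (forall w, 0 <= w -> k (f w) = inf [set k q | q in workload_fiber G w]) ->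
    k (dynamics G x psi (feedback_control G x f psi) t) <=
    k (dynamics G x psi zeta t).
  move=> kP tT fk; rewrite dynamics_feedback fk; last exact: workload_ge0.
  apply: fiber_inf_le => //; first exact: dyn0.
  by rewrite workload_ge0 //= workload_le.
have run_continuous z : {within `[0, T], continuous z} ->
    (forall t, 0 <= t <= T -> orthant (z t)) ->
    measurable_fun `[0, T]%classic (EFin \o (fun t => run_cost G (z t))).
  move=> zc z0; apply/measurable_EFinP.
  apply: subspace_continuous_measurable_fun => //.
  have [_ kc _] := runP.
  apply: continuous_comp_within zc kc => t /=; rewrite in_itv /=; exact: z0.
have [zetac _ _] := zetaP; have [run_ge0 _ _] := runP.
apply: leeD => //; apply: leeD; last by rewrite lee_fin cost_le ?T0 ?lexx.
apply: ge0_le_integral => //.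
- move=> t /=; rewrite in_itv /= => tT; rewrite lee_fin; apply: run_ge0.
  by rewrite dynamics_feedback; exact/f_orthant/workload_ge0.
- apply: run_continuous => [|t tT]; last first.
    by rewrite dynamics_feedback; exact/f_orthant/workload_ge0.
  have -> : dynamics G x psi (feedback_control G x f psi) =
      fun t => f (workload G x psi t) by apply/funext => t; exact: dynamics_feedback.
  exact: feedback_path_continuous.
- apply: run_continuous => // t; apply: cvgD; last exact: zetac.
  exact: free_dynamics_continuous.
- by move=> t /=; rewrite in_itv /= => tT; rewrite lee_fin cost_le.
Qed.

End feedback.
End game.

(** * Optimality *)

Theorem proposition3p1 (R : realType) (n : nat) (G : game_data R n)
  (horizon_gt0 : 0 < horizon G)
  (arr_rate_gt0 : forall i, 0 < arr_rate G i)
  (srv_rate_gt0 : forall i, 0 < srv_rate G i)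
  (arr_var_gt0 : forall i, 0 < arr_var G i)
  (srv_var_gt0 : forall i, 0 < srv_var G i)
  (critical_load : \sum_(i < n) rho G i = 1)
  (run_costP : cost_function (run_cost G))
  (end_costP : cost_function (end_cost G))
  (linear_growth : exists c1 c2 : R, forall q : 'rV[R]_n, orthant q ->
     end_cost G q + run_cost G q <= c1 * euclidean_norm q + c2)
  (x : 'rV[R]_n) (x_orthant : orthant x)
  (f : R -> 'rV[R]_n)
  (f_continuous : {within `[0, +oo[, continuous f})
  (f_orthant : forall w : R, 0 <= w -> orthant (f w))
  (f_workload : forall w : R, 0 <= w -> dot (theta G) (f w) = w)
  (f_min_run_cost : forall w : R, 0 <= w ->
     run_cost G (f w) = inf [set run_cost G q | q in workload_fiber G w])
  (f_min_end_cost : forall w : R, 0 <= w ->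
     end_cost G (f w) = inf [set end_cost G q | q in workload_fiber G w]) :
  admissible G x (feedback_control G x f) /\
  game_value G x =
    ereal_sup [set game_cost G x psi (feedback_control G x f psi)
              | psi in perturbations G].
Proof.
have T0 := ltW horizon_gt0.
have feedP : admissible G x (feedback_control G x f).
  exact: feedback_admissible.
split => //; apply/eqP; rewrite eq_le; apply/andP; split.
  by apply: ereal_inf_lbound; exists (feedback_control G x f).
apply/ereal_infP => _ [alpha [[alphaP _ _] dyn0] <-].
apply/ereal_supP => _ [psi psiP <-].
apply: (@le_trans _ _ (game_cost G x psi (alpha psi))); last first.
  by apply: ereal_sup_ubound; exists psi.
apply: feedback_cost_le => //; first exact: alphaP.
by move=> t tT; apply: dyn0; rewrite ?in_itv.
Qed.
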